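(* Let $H=(kG)^*\#kL$ be a cocentral abelian extension with trivial cocycle and trivial dual cocycle. Assume the following three conditions hold: (i) for all $g\in G$ and all simple $\tilde L_g$-modules $V$, the classical Frobenius–Schur indicator satisfies $\tilde\nu(V)=1$; (ii) for all $g\in G$, if $d\in\tilde L_g\setminus L_g$ then the conjugation action of $d$ on $L_g$-modules sends (the isomorphism class of) $V$ to that of the dual $V^*$; (iii) for all $g\in G$ of order at least $3$, $\tilde L_g\ne L_g$. Then every simple $H$-module has Schur indicator equal to $1$.
   Context: $k$ is an algebraically closed field of characteristic not $2$; $G,L$ are finite groups with $\operatorname{char}k\nmid |G||L|$; $L$ acts on $G$ by group automorphisms, $(x,g)\mapsto x\rightharpoonup g$. Let $\{p_g\}_{g\in G}$ be the basis of $(kG)^*$ dual to $G$. $H=(kG)^*\#kL$ is the Hopf algebra with basis $\{p_gx: g\in G,x\in L\}$, unit $\sum_g p_g1$ and $$(p_gx)(p_hy)=\delta_{g,\,x\rightharpoonup h}\,p_g(xy),\qquad \Delta(p_gx)=\sum_{h\in G}p_hx\otimes p_{h^{-1}g}x,\qquad \varepsilon(p_gx)=\delta_{g,1},\qquad S(p_gx)=p_{x^{-1}\rightharpoonup g^{-1}}x^{-1}.$$ Schur indicator: for a semisimple Hopf algebra with integral $\Lambda$, $\varepsilon(\Lambda)=1$, the indicator of a module with character $\chi$ is $\chi(\sum\Lambda_1\Lambda_2)$; for a group algebra $kF$ this is the classical $\frac1{|F|}\sum_{z\in F}\chi(z^2)$. Notation: $L_{g,h}=\{y\in L: y\rightharpoonup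 g=h\}$; $L_g=L_{g,g}$; $\tilde L_g=L_g\cup L_{g,g^{-1}}$, a subgroup of $L$ containing $L_g$ with index at most $2$. For $d\in\tilde L_g$ and an $L_g$-module $V$ with character $\chi$, the $d$-conjugate module has character $\chi^d(y)=\chi(dyd^{-1})$, $y\in L_g$. *)

(* Defs.v *)
From HB Require Import structures.
From mathcomp Require Import all_boot all_order all_algebra all_fingroup
  all_character.

Set Implicit Arguments.
Unset Strict Implicit.
Unset Printing Implicit Defensive.

Import GroupScope GRing.Theory.
Local Open Scope ring_scope.

(* A left action by group automorphisms; the library's groupAction is a right
   action. *)
Record autAction (lT gT : finGroupType) := AutAction {
  act_fun :> lT -> gT -> gT;
  _ : forall g, act_fun 1%g g = g;
  _ : forall x y g, act_fun (x * y)%g g = act_fun x (act_fun y g);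
  _ : forall x g h, act_fun x (g * h)%g = (act_fun x g * act_fun x h)%g
}.

Section Stabilizers.
Variables (lT gT : finGroupType) (act : autAction lT gT).
Implicit Types (x y d : lT) (g h : gT).

Lemma lact1 g : act 1%g g = g. Proof. by case: act. Qed.
Lemma lactM x y g : act (x * y)%g g = act x (act y g).
Proof. by case: act. Qed.
Lemma lactG x g h : act x (g * h)%g = (act x g * act x h)%g.
Proof. by case: act. Qed.
Lemma lactK x : cancel (act x) (act x^-1%g).
Proof. by move=> g; rewrite -lactM mulVg lact1. Qed.
Lemma lactVK x : cancel (act x^-1%g) (act x).
Proof. by move=> g; rewrite -lactM mulgV lact1. Qed.
Lemma lact_1 x : act x 1%g = 1%g.
Proof. by apply: (mulIg (act x 1%g)); rewrite -lactG !mul1g. Qed.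
Lemma lactV x g : act x g^-1%g = (act x g)^-1%g.
Proof. by apply: (mulIg (act x g)); rewrite -lactG !mulVg lact_1. Qed.

Definition transporter g h : {set lT} := [set y | act y g == h].
Definition Lstab g : {set lT} := transporter g g.
Definition Ltilde g : {set lT} := Lstab g :|: transporter g g^-1%g.

Lemma Lstab_group_set g : group_set (Lstab g).
Proof.
apply/group_setP; split=> [|x y]; rewrite !inE ?lact1 //.
by move=> /eqP gx /eqP gy; rewrite lactM gy gx.
Qed.
Canonical Lstab_group g := Group (Lstab_group_set g).

Lemma Ltilde_group_set g : group_set (Ltilde g).
Proof.
apply/group_setP; split=> [|x y]; rewrite !inE ?lact1 ?eqxx // lactM.
by move=> /orP[] /eqP gx /orP[] /eqP gy; rewrite gy ?lactV gx ?invgK eqxx ?orbT.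
Qed.
Canonical Ltilde_group g := Group (Ltilde_group_set g).

Lemma Lstab_conj g d y :
  d \in Ltilde g -> y \in Lstab g -> (d * y * d^-1)%g \in Lstab g.
Proof.
rewrite -groupV !inE !lactM => + /eqP gy.
by case/orP=> /eqP dg; rewrite dg ?(lactV y) gy -{1}dg lactVK.
Qed.

End Stabilizers.

Section GroupRepr.
Variables (k : fieldType) (lT : finGroupType).

Section Dual.
Variables (F : {group lT}) (n : nat) (rV : mx_representation k F n).

Lemma dual_mx_repr : mx_repr F (fun y => (rV y^-1%g)^T).
Proof.
split=> [|x y Fx Fy]; first by rewrite invg1 repr_mx1 trmx1.
by rewrite invMg repr_mxM ?groupV // trmx_mul.
Qed.
Definition dual_repr := MxRepresentation dual_mx_repr.

Definition classical_indicator : k :=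
  #|F|%:R^-1 * \sum_(z in F) \tr (rV (z ^+ 2)%g).

End Dual.

Section Conjugate.
Variables (gT : finGroupType) (act : autAction lT gT) (g : gT) (d : lT).
Hypothesis dLt : d \in Ltilde act g.
Variables (n : nat) (rV : mx_representation k (Lstab act g) n).

Lemma conj_mx_repr : mx_repr (Lstab act g) (fun y => rV (d * y * d^-1)%g).
Proof.
split=> [|x y Fx Fy]; first by rewrite mulg1 mulgV repr_mx1.
rewrite -repr_mxM ?Lstab_conj //; congr (rV _).
by rewrite !mulgA mulgKV.
Qed.
Definition conj_repr := MxRepresentation conj_mx_repr.

End Conjugate.
End GroupRepr.

Section SmashDef.
Variables (k : fieldType) (lT gT : finGroupType).

(* The value of a : smash act at (g, x) is the coefficient of a on p_g x, and
   likewise for smash_tensor act, which is H (x) H in the product basis. *)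
Definition smash (act : autAction lT gT) : Type := {ffun gT * lT -> k^o}.
Definition smash_tensor (act : autAction lT gT) : Type :=
  {ffun (gT * lT) * (gT * lT) -> k^o}.

Variable act : autAction lT gT.
HB.instance Definition _ := GRing.Lmodule.on (smash act).
HB.instance Definition _ := GRing.Lmodule.on (smash_tensor act).

Definition smash_p (g : gT) (x : lT) : smash act :=
  [ffun u => (u == (g, x))%:R].
Definition tensor (a b : smash act) : smash_tensor act :=
  [ffun w => a w.1 * b w.2].

(* The multiplication map H (x) H -> H. *)
Definition smash_mult (t : smash_tensor act) : smash act :=
  \sum_(u : gT * lT) \sum_(v : gT * lT)
    (t (u, v) *+ (u.1 == act u.2 v.1)) *: smash_p u.1 (u.2 * v.2)%g.
Definition smash_mul (a b : smash act) : smash act := smash_mult (tensor a b).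
Definition smash_one : smash act := \sum_(g : gT) smash_p g 1%g.

Definition comult (a : smash act) : smash_tensor act :=
  \sum_(u : gT * lT) a u *:
    \sum_(h : gT) tensor (smash_p h u.2) (smash_p (h^-1 * u.1)%g u.2).
Definition counit (a : smash act) : k :=
  \sum_(u : gT * lT) a u * (u.1 == 1%g)%:R.
Definition antipode (a : smash act) : smash act :=
  \sum_(u : gT * lT) a u *: smash_p (act u.2^-1%g u.1^-1%g) u.2^-1%g.

End SmashDef.

Section SmashTheory.
Variables (k : fieldType) (lT gT : finGroupType) (act : autAction lT gT).
Local Notation H := (smash k act).
Local Notation p := (smash_p k act).
Implicit Types (a b c : H) (g h : gT) (x y : lT).

Lemma smash_multE (t : smash_tensor k act) g z :
  smash_mult t (g, z) =
    \sum_x t ((g, x), (act x^-1%g g, (x^-1 * z)%g)).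
Proof.
rewrite /smash_mult sum_ffunE; transitivity (\sum_h \sum_x
    (\sum_v (t ((h, x), v) *+ (h == act x v.1)) *: p h (x * v.2)%g) (g, z)).
  by rewrite pair_bigA /=; apply: eq_bigr => -[].
rewrite (bigD1 g) //= [X in _ + X]big1 ?addr0 => [|h /negPf gh].
  apply: eq_bigr => x _; rewrite sum_ffunE.
  rewrite (bigD1 (act x^-1%g g, (x^-1 * z)%g)) //= [X in _ + X]big1.
    by rewrite addr0 !ffunE lactVK mulKVg !eqxx mulr1n /GRing.scale /= mulr1.
  case=> h y /= neq; rewrite !ffunE xpair_eqE eqxx /=.
  case: (g =P _) => [gE|_]; last by rewrite mulr0n scale0r.
  case: (z =P _) => [zE|_]; last by rewrite scaler0.
  by rewrite gE zE lactK mulKg eqxx in neq.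
apply: big1 => x _; rewrite sum_ffunE big1 // => v _.
by rewrite !ffunE xpair_eqE [g == h]eq_sym gh /= scaler0.
Qed.

Lemma smash_mulE a b g z :
  smash_mul a b (g, z) =
    \sum_x a (g, x) * b (act x^-1%g g, (x^-1 * z)%g).
Proof. by rewrite smash_multE; apply: eq_bigr => x _; rewrite !ffunE. Qed.

Lemma smash_oneE g x : smash_one k act (g, x) = (x == 1%g)%:R.
Proof.
rewrite sum_ffunE (bigD1 g) //= big1 ?addr0 => [|h /negPf gh].
  by rewrite !ffunE xpair_eqE eqxx.
by rewrite !ffunE xpair_eqE eq_sym gh.
Qed.

Fact smash_mulA : associative (@smash_mul k _ _ act).
Proof.
move=> a b c; apply/ffunP=> -[g z]; rewrite !smash_mulE.
under eq_bigr do rewrite smash_mulE mulr_sumr.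
under [RHS]eq_bigr do rewrite smash_mulE mulr_suml.
rewrite [RHS]exchange_big /=; apply: eq_bigr => x _.
rewrite (reindex_inj (mulgI x^-1%g)) /=; apply: eq_bigr => y _.
by rewrite mulrA invMg invgK -lactM mulgK -mulgA mulKVg.
Qed.
Fact smash_mul1 : left_id (smash_one k act) (@smash_mul k _ _ act).
Proof.
move=> a; apply/ffunP=> -[g z]; rewrite smash_mulE (bigD1 1%g) //=.
rewrite big1 ?addr0 => [|x /negPf x1]; last by rewrite smash_oneE x1 mul0r.
by rewrite smash_oneE eqxx mul1r invg1 lact1 mul1g.
Qed.
Fact smash_mulr1 : right_id (smash_one k act) (@smash_mul k _ _ act).
Proof.
move=> a; apply/ffunP=> -[g z]; rewrite smash_mulE (bigD1 z) //=.
rewrite big1 ?addr0 => [|x /negPf xz]; last first.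
  by rewrite smash_oneE -eq_mulVg1 xz mulr0.
by rewrite smash_oneE mulVg eqxx mulr1.
Qed.
Fact smash_mulDl : left_distributive (@smash_mul k _ _ act) +%R.
Proof.
move=> a b c; apply/ffunP=> -[g z]; rewrite ffunE !smash_mulE -big_split /=.
by apply: eq_bigr => x _; rewrite ffunE mulrDl.
Qed.
Fact smash_mulDr : right_distributive (@smash_mul k _ _ act) +%R.
Proof.
move=> a b c; apply/ffunP=> -[g z]; rewrite ffunE !smash_mulE -big_split /=.
by apply: eq_bigr => x _; rewrite ffunE mulrDr.
Qed.
Fact smash_1neq0 : smash_one k act != 0.
Proof.
apply/eqP=> /ffunP/(_ (1%g, 1%g)); rewrite smash_oneE ffunE eqxx.
by move/eqP; rewrite oner_eq0.
Qed.
HB.instance Definition _ := GRing.Zmodule_isNzRing.Build H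
  smash_mulA smash_mul1 smash_mulr1 smash_mulDl smash_mulDr smash_1neq0.

Fact smash_scaleAl (e : k) a b : e *: (a * b) = (e *: a) * b.
Proof.
apply/ffunP=> -[g z]; rewrite ffunE !smash_mulE scaler_sumr.
by apply: eq_bigr => x _; rewrite ffunE -scalerAl.
Qed.
HB.instance Definition _ := GRing.Lmodule_isLalgebra.Build k H smash_scaleAl.
Fact smash_scaleAr (e : k) a b : e *: (a * b) = a * (e *: b).
Proof.
apply/ffunP=> -[g z]; rewrite ffunE !smash_mulE scaler_sumr.
by apply: eq_bigr => x _; rewrite ffunE -scalerAr.
Qed.
HB.instance Definition _ := GRing.Lalgebra_isAlgebra.Build k H smash_scaleAr.

Lemma smash_pM g x h y :
  p g x * p h y = if g == act x h then p g (x * y)%g else 0.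
Proof.
apply/ffunP=> -[g' z]; rewrite smash_mulE (bigD1 x) //=.
rewrite big1 ?addr0 => [|w /negPf wx]; last first.
  by rewrite ffunE xpair_eqE wx andbF mul0r.
rewrite !ffunE !xpair_eqE eqxx andbT (can2_eq (lactVK act x) (lactK act x)).
rewrite (can2_eq (mulKVg x) (mulKg x)) -natrM mulnb.
case: (g' =P g) => [->|ng] /=; case: (g =P act x h) => _ //=; rewrite !ffunE //.
by rewrite xpair_eqE eqxx.
by rewrite xpair_eqE; case: eqP.
Qed.

Lemma smash_sumE a : a = \sum_(u : gT * lT) a u *: p u.1 u.2.
Proof.
apply/ffunP=> w; rewrite sum_ffunE (bigD1 w) //= big1 ?addr0 => [|u neq].
  by rewrite !ffunE -surjective_pairing eqxx /GRing.scale /= mulr1.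
by rewrite !ffunE -surjective_pairing eq_sym (negPf neq) scaler0.
Qed.

Lemma sum_smash_p (V : lmodType k) g x (f : gT * lT -> V) :
  \sum_u (p g x u : k) *: f u = f (g, x).
Proof.
rewrite (bigD1 (g, x)) //= big1 ?addr0 => [|u neq].
  by rewrite ffunE eqxx scale1r.
by rewrite ffunE (negPf neq) scale0r.
Qed.

Lemma comult_p g x :
  comult (p g x) = \sum_h tensor (p h x) (p (h^-1 * g)%g x).
Proof. exact: sum_smash_p. Qed.
Lemma counit_p g x : counit (p g x) = (g == 1%g)%:R.
Proof. exact: (@sum_smash_p k^o g x (fun u => (u.1 == 1%g)%:R)). Qed.
Lemma antipode_p g x :
  antipode (p g x) = p (act x^-1%g g^-1%g) x^-1%g.
Proof. exact: sum_smash_p. Qed.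

Definition left_integral (Lam : H) : Prop :=
  forall a : H, a * Lam = counit a *: Lam.

(* A normalized integral exists and is unique, so a quantification over all of
   them is a statement about a single element. *)
Lemma smash_integralP (Lam : H) : #|lT|%:R != 0 :> k ->
  left_integral Lam /\ counit Lam = 1 <->
  Lam = #|lT|%:R^-1 *: \sum_(x : lT) p 1%g x.
Proof.
move=> nz; set S := \sum_x _.
have pS g x : p g x * S = (g == 1%g)%:R *: S.
  rewrite mulr_sumr; under eq_bigr do rewrite smash_pM lact_1.
  case: eqP => [->|_]; last by rewrite big1 // scale0r.
  by rewrite scale1r [RHS](reindex_inj (mulgI x)).
have Sp g x : S * p g x = (g == 1%g)%:R *: S.
  have act1 y : (1%g == act y g) = (g == 1%g).
    by rewrite -{1}(lact_1 act y) (inj_eq (can_inj (lactK act y))) eq_sym.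
  rewrite mulr_suml; under eq_bigr do rewrite smash_pM act1.
  case: eqP => [_|_]; last by rewrite big1 // scale0r.
  by rewrite scale1r [RHS](reindex_inj (mulIg x)).
have aS a : a * S = counit a *: S.
  rewrite {1}[a]smash_sumE mulr_suml scaler_suml; apply: eq_bigr => u _.
  by rewrite -scalerAl pS scalerA.
have Sa a : S * a = counit a *: S.
  rewrite {1}[a]smash_sumE mulr_sumr scaler_suml; apply: eq_bigr => u _.
  by rewrite -scalerAr Sp scalerA.
have cZ e a : counit (e *: a) = e * counit a.
  by rewrite mulr_sumr; apply: eq_bigr => u _; rewrite ffunE mulrA.
have cS : counit S = #|lT|%:R.
  transitivity (\sum_x counit (p 1%g x)).
    rewrite exchange_big /=; apply: eq_bigr => u _.
    by rewrite sum_ffunE mulr_suml.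
  by under eq_bigr do rewrite counit_p eqxx; rewrite sumr_const.
split=> [[intL cL]|->].
  have := intL S; rewrite Sa cL cS scale1r => ->.
  by rewrite scalerA mulVf // scale1r.
split=> [a|]; last by rewrite cZ cS mulVf.
by rewrite -scalerAr aS !scalerA mulrC.
Qed.

End SmashTheory.

(* rho is the left A-module k^n.+1 of column vectors, on which a acts by
   v |-> rho a *m v; the library's mx_irreducible is about row spaces. *)
Definition simple_module (k : fieldType) (A : lalgType k) (n : nat)
    (rho : {lrmorphism A -> 'M[k]_n.+1}) : Prop :=
  forall W : {vspace 'cV[k]_n.+1},
    (forall (a : A) (v : 'cV[k]_n.+1), v \in W -> rho a *m v \in W) ->
    W = 0%VS \/ W = fullv.

Definition schur_indicator (k : fieldType) (lT gT : finGroupType)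
    (act : autAction lT gT) (Lam : smash k act) (n : nat)
    (rho : {lrmorphism smash k act -> 'M[k]_n.+1}) : k :=
  \tr (rho (smash_mult (comult Lam))).

(* Main.v *)
(* The indicator of a simple module rho is 1/|L| times the sum over h of the sums
   of tr rho(p_h x^2) over the x with x.h = h^-1; the inner sum depends only on
   the orbit of h and vanishes off a single orbit. If g lies in that orbit, the
   indicator is 1/|L_g| times the sum of chi(x^2) over the x with x.g = g^-1, where chi is the
   character of the simple L_g-module X on the image of p_g.
   If g = g^-1 this is the indicator of X, a simple module of L_g = L~_g.
   Otherwise L_g has index 2 in K = L~_g, and X conjugated by d in K \ L_g is the
   dual of X. If X is not self-dual, then its own indicator vanishes and its
   induction to K is simple, of indicator equal to the sum wanted, hence 1. If X
   is self-dual, it extends to K; by Schur orthogonality both its indicator and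
   the sum wanted are 1 or -1, while their mean is the indicator of the extension,
   that is 1. *)
Require Import Defs.
From HB Require Import structures.
From mathcomp Require Import ring.
From mathcomp Require Import all_boot all_order all_algebra all_fingroup
  all_solvable all_character.

Set Implicit Arguments.
Unset Strict Implicit.
Unset Printing Implicit Defensive.

Import GroupScope GRing.Theory.
Local Open Scope ring_scope.

(** * Schur's lemma for intertwiners and its converse *)

Section Schur.
Variables (k : fieldType) (lT : finGroupType) (F : {group lT}).

(** The left kernel of an intertwiner is a submodule of [X], and a proper one when [T] is
    nonzero. *)
Lemma intertwiner_row_free n m (X : mx_representation k F n)
    (Y : mx_representation k F m) (T : 'M_(n, m)) :
    mx_irreducible X -> (forall y, y \in F -> X y *m T = T *m Y y) ->
  T != 0 -> row_free T.
Proof.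
case/mx_irrP=> _ simX hT; apply: contraR; rewrite -kermx_eq0 => nzK.
have modK: mxmodule X (kermx T).
  apply/mxmoduleP=> y Fy; apply/sub_kermxP.
  by rewrite -mulmxA hT // mulmxA mulmx_ker mul0mx.
have := simX _ modK nzK; rewrite -sub1mx => /sub_kermxP.
by rewrite mul1mx => ->.
Qed.

(** The projection onto a submodule [U] along a Maschke complement is an endomorphism, hence a
    scalar; fixing the nonzero [U], it is 1, and its image [U] is everything. *)
Lemma centg_scalar_irr n (X : mx_representation k F n) :
    [pchar k]^'.-group F -> (0 < n)%N ->
    (forall A, centgmx X A -> is_scalar_mx A) ->
  mx_irreducible X.
Proof.
move=> charF n0 cX; apply/mx_irrP; split=> // U modU nzU.
have [W modW eqUW dxUW] := mx_Maschke_pchar X charF modU (submx1 U).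
have /mxdirect_addsP capUW := dxUW.
have /is_scalar_mxP[c pE]: is_scalar_mx (proj_mx U W).
  by apply: cX; rewrite -row_full_dom_hom -sub1mx -eqUW proj_mx_hom.
have UE: U *m c%:M = U by rewrite -pE proj_mx_id.
have c1: c = 1.
  have /eqP: (c - 1) *: U = 0.
    by rewrite scalerBl scale1r -mul_mx_scalar UE subrr.
  by rewrite scaler_eq0 (negPf nzU) orbF subr_eq0 => /eqP.
by rewrite -sub1mx -[1%:M]mul1mx -c1 -pE proj_mx_sub.
Qed.

End Schur.

(** * Schur orthogonality and indicator sums over an algebraically closed field *)

Section ClosedSchur.
Variables (k : closedFieldType) (lT : finGroupType) (F : {group lT}).

(** Subtracting an eigenvalue from [A] leaves a singular endomorphism, which Schur's lemma forces to
    vanish. *)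
Lemma closed_irr_centg_scalar n (X : mx_representation k F n) A :
  mx_irreducible X -> centgmx X A -> exists c, A = c%:M.
Proof.
move=> irrX cXA; have [n0 _] := (mx_irrP X).1 irrX.
have [c cA]: exists c, eigenvalue A c.
  have /closed_rootP[c rc]: size (char_poly A) != 1%N.
    by rewrite size_char_poly eqSS -lt0n.
  by exists c; rewrite eigenvalue_root_char.
exists c; apply/eqP; rewrite -subr_eq0; apply: contraLR cA => nz.
rewrite negbK /eigenspace kermx_eq0 row_free_unit.
apply: (mx_Schur irrX) => //; apply/centgmxP=> y Fy.
by rewrite mulmxBl mulmxBr (centgmxP cXA) // scalar_mxC.
Qed.

Lemma schur_orthogonality n (X : mx_representation k F n) i j l m :
    mx_irreducible X ->
  n%:R * \sum_(x in F) X x i j * X x^-1%g l m =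
    #|F|%:R *+ ((j == l) && (i == m)).
Proof.
move=> irrX; pose T := \sum_(x in F) col j (X x) *m row l (X x^-1%g).
have [c TE]: exists c, T = c%:M.
  apply: (closed_irr_centg_scalar irrX); apply/centgmxP=> y Fy.
  rewrite mulmx_suml mulmx_sumr [LHS](reindex_inj (mulgI y)) /=.
  apply: eq_big => [x|x]; rewrite groupMl // => Fx.
  rewrite invMg !repr_mxM ?groupV // !colE !row_mul.
  by rewrite -!mulmxA -repr_mxM ?groupV // mulVg repr_mx1 mulmx1.
have trT: \tr T = #|F|%:R *+ (j == l).
  rewrite linear_sum -[RHS]mulr_natl -natrM mulnC natrM mulr_natl -sumr_const.
  apply: eq_bigr => x Fx /=.
  rewrite mxtrace_mulC -row_mul colE mulmxA -colE -repr_mxM ?groupV //.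
  rewrite mulVg repr_mx1.
  by rewrite /mxtrace big_ord1 !mxE eq_sym.
have Tim: T i m = \sum_(x in F) X x i j * X x^-1%g l m.
  by rewrite summxE; apply: eq_bigr => x _; rewrite mxE big_ord1 !mxE.
rewrite -Tim TE mxE -mulnb mulrnA -trT TE mxtrace_scalar.
by rewrite mulr_natl mulrnAC.
Qed.

Lemma irr_degree_neq0 n (X : mx_representation k F n) :
  [pchar k]^'.-group F -> mx_irreducible X -> n%:R != 0 :> k.
Proof.
rewrite /pgroup pcharf'_nat => nzF irrX; have [n0 _] := (mx_irrP X).1 irrX.
have := schur_orthogonality (Ordinal n0) (Ordinal n0) (Ordinal n0) (Ordinal n0) irrX.
by rewrite eqxx; apply: contra_eq_neq => ->; rewrite mul0r eq_sym.
Qed.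

(** Expanded in matrix entries, the sum over [x] is a combination of the sums in
    [schur_orthogonality], of which only those with j = l and m = i survive. *)
Lemma sum_tr_repr_twist n (X : mx_representation k F n) (B M : 'M_n) :
    mx_irreducible X ->
  n%:R * \sum_(x in F) \tr (X x *m B *m (X x^-1%g)^T *m M) =
    #|F|%:R * \tr (B^T *m M).
Proof.
move=> irrX.
transitivity (n%:R * \sum_i \sum_l \sum_m \sum_j
    B j m * M l i * \sum_(x in F) X x i j * X x^-1%g l m).
  congr (_ * _).
  rewrite exchange_big; apply: eq_bigr => i _ /=.
  under eq_bigr do rewrite mxE; rewrite exchange_big; apply: eq_bigr => l _ /=.
  under eq_bigr do rewrite mxE mulr_suml.
  rewrite exchange_big; apply: eq_bigr => m _ /=.
  under eq_bigr do rewrite !mxE !mulr_suml.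
  rewrite exchange_big; apply: eq_bigr => j _ /=.
  by rewrite mulr_sumr; apply: eq_bigr => x _; ring.
rewrite !mulr_sumr; apply: eq_bigr => i _.
rewrite mxE !mulr_sumr; apply: eq_bigr => l _.
rewrite mulr_sumr (bigD1 i) //= [X in _ + X]big1 ?addr0 => [|m /negPf mi].
  rewrite mulr_sumr (bigD1 l) //= [X in _ + X]big1 ?addr0 => [|j /negPf jl].
    by rewrite mulrCA schur_orthogonality // !eqxx mxE mulrC.
  by rewrite mulrCA schur_orthogonality // jl mulr0.
rewrite mulr_sumr big1 // => j _.
by rewrite mulrCA schur_orthogonality // [i == m]eq_sym mi andbF mulr0.
Qed.

(* The hypothesis identifies the conjugate of X by d with its dual; then B^T B^-1
   X (d^2) commutes with X, and the scalar it equals is the sum's sign. *)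
Lemma twisted_indicator_sign n (X : mx_representation k F n) d (B : 'M_n) :
    [pchar k]^'.-group F -> mx_irreducible X ->
    d \in 'N(F) -> (d * d)%g \in F -> B \in unitmx ->
    (forall y, y \in F -> X (d * y * d^-1)%g *m B = B *m (X y^-1%g)^T) ->
  exists2 e : k, e ^+ 2 = 1
    & \sum_(y in F) \tr (X (y * d * (y * d))%g) = #|F|%:R * e.
Proof.
move=> charF irrX Nd Fd2 uB XdB; have [n0 _] := (mx_irrP X).1 irrX.
have Fdy y : y \in F -> (d * y * d^-1)%g \in F.
  have -> : (d * y * d^-1 = y ^ d^-1)%g by rewrite conjgE invgK mulgA.
  by rewrite memJ_norm // groupV.
have uBT: B^T \in unitmx by rewrite unitmx_tr.
have Xd y : y \in F -> X (d * y * d^-1)%g = B *m (X y^-1%g)^T *m invmx B.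
  by move=> Fy; rewrite -XdB // mulmxK.
(* Chosen so that X((yd)^2) = X(y) X(d y d^-1) X(d^2) becomes X(y) B X(y^-1)^T M, the shape
   evaluated by [sum_tr_repr_twist]. *)
pose M := invmx B *m X (d * d)%g.
have [e BM]: exists e, B^T *m M = e%:M.
  apply: (closed_irr_centg_scalar irrX); apply/centgmxP=> y Fy.
  have -> : B^T *m M *m X y = B^T *m invmx B *m X (d * d * y)%g.
    by rewrite repr_mxM // !mulmxA.
  have -> : (d * d * y = d * (d * y * d^-1) * d^-1 * (d * d))%g.
    by rewrite !mulgA !mulgKV.
  have Xdy : X (d * y * d^-1)^-1%g = B *m (X y)^T *m invmx B.
    by rewrite !invMg invgK mulgA Xd ?groupV // invgK.
  rewrite repr_mxM ?Fdy // Xd ?Fdy // Xdy.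
  rewrite !trmx_mul trmxK trmx_inv !mulmxA.
  by rewrite mulmxKV // mulmxV // mul1mx.
have MB : M = e *: invmx B^T by rewrite -[M](mulKmx uBT) BM mul_mx_scalar.
(* Since d commutes with d^2, the hypothesis at y = d^2 expresses X(d^-2)^T through B and e.
   Multiplying it by X(d^2)^T, all the factors B cancel and e^2 = 1 is left. *)
exists e.
  have QE : X (d * d)%g = e *: (B *m invmx B^T).
    by rewrite scalemxAr -MB mulKVmx.
  have Q'E : (X (d * d)^-1%g)^T = e *: (invmx B^T *m B).
    have := XdB _ Fd2; rewrite mulgA mulgK QE => /(congr1 (mulmx (invmx B))).
    by rewrite mulKmx // -scalemxAl -scalemxAr -!mulmxA mulKmx.
  have : (X (d * d)^-1%g *m X (d * d)%g)^T = 1%:M.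
    by rewrite -repr_mxM ?groupV // mulVg repr_mx1 trmx1.
  have QT : (X (d * d)%g)^T = e *: (invmx B *m B^T).
    by rewrite QE linearZ /= trmx_mul trmx_inv trmxK.
  rewrite trmx_mul Q'E QT -scalemxAl -scalemxAr scalerA !mulmxA mulmxK //.
  rewrite mulVmx // => /matrixP/(_ (Ordinal n0) (Ordinal n0)).
  by rewrite !mxE eqxx mulr1.
have nn := irr_degree_neq0 charF irrX; apply: (mulfI nn).
have trM : n%:R * e = \tr (B^T *m M) by rewrite BM mxtrace_scalar mulr_natl.
rewrite [RHS]mulrCA trM -(sum_tr_repr_twist _ _ irrX).
congr (_ * _); apply: eq_bigr => y Fy; congr (\tr _).
have -> : (y * d * (y * d) = y * (d * y * d^-1) * (d * d))%g.
  by rewrite !mulgA mulgKV.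
have Fyd : (y * (d * y * d^-1))%g \in F by rewrite groupM ?Fdy.
by rewrite (repr_mxM _ Fyd) // repr_mxM ?Fdy // Xd // /M !mulmxA.
Qed.

(** For every matrix unit E_jl, the sum of the X(x) E_jl X(x)^T intertwines [X] with its dual, so it
    is zero; tr X(x^2) is a sum of products of entries that occur in these matrices. *)
Lemma sum_tr_sqr_nondual n (X : mx_representation k F n) :
    mx_irreducible X -> ~ mx_rsim X (dual_repr X) ->
  \sum_(y in F) \tr (X (y * y)%g) = 0.
Proof.
move=> irrX nXX.
have T0 j l : \sum_(x in F) col j (X x) *m row l (X x)^T = 0.
  apply/eqP; apply: contra_notT nXX => nzT.
  have hT y : y \in F ->
    X y *m (\sum_(x in F) col j (X x) *m row l (X x)^T) =
    (\sum_(x in F) col j (X x) *m row l (X x)^T) *m dual_repr X y.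
    move=> Fy; rewrite mulmx_suml mulmx_sumr [RHS](reindex_inj (mulgI y)) /=.
    apply: eq_big => [x|x Fx]; rewrite ?groupMl //.
    rewrite !repr_mxM // trmx_mul !colE !row_mul -!mulmxA -trmx_mul.
    by rewrite -repr_mxM ?groupV // mulVg repr_mx1 trmx1 mulmx1.
  by exists (\sum_(x in F) col j (X x) *m row l (X x)^T) => //;
    apply: intertwiner_row_free hT nzT.
transitivity (\sum_i \sum_j \sum_(x in F) X x i j * X x j i).
  under [RHS]eq_bigr => i _ do rewrite exchange_big /=.
  rewrite [RHS]exchange_big /=; apply: eq_bigr => x Fx.
  by rewrite repr_mxM //; apply: eq_bigr => i _; rewrite mxE.
apply: big1 => i _; apply: big1 => j _.
have /matrixP/(_ i j) := T0 j i; rewrite mxE summxE => {2}<-.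
by apply: eq_bigr => x _; rewrite mxE big_ord1 !mxE.
Qed.

End ClosedSchur.

(** * Extension and induction of representations from a subgroup of index two *)

Section IndexTwo.
Variables (lT : finGroupType) (K F : {group lT}) (d : lT).
Hypotheses (sFK : F \subset K) (idx2 : #|K : F|%g = 2%N) (Kd : d \in K :\: F).

Lemma index2_mulVr x : x \in K -> x \notin F -> (x * d^-1)%g \in F.
Proof.
move=> Kx nFx; rewrite -mem_rcoset (rcoset_index2 sFK idx2 Kd).
by rewrite inE Kx nFx.
Qed.

Lemma index2_norm : d \in 'N(F).
Proof.
have /andP[_ /subsetP] := index2_normal sFK idx2; apply.
by case/setDP: Kd.
Qed.

Lemma index2_conj y : y \in F -> (d * y * d^-1)%g \in F.
Proof.
have -> : (d * y * d^-1 = y ^ d^-1)%g by rewrite conjgE invgK mulgA.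
by rewrite memJ_norm // groupV index2_norm.
Qed.

Lemma index2_sqr : (d * d)%g \in F.
Proof.
have [dK dF] := setDP Kd.
by rewrite -groupV invMg index2_mulVr ?groupV.
Qed.

Lemma index2_mull x : x \in K -> x \notin F -> (d * x)%g \in F.
Proof.
move=> Kx nFx.
have -> : (d * x = d * (x * d^-1) * d^-1 * (d * d))%g.
  by rewrite !mulgA !mulgKV.
by rewrite groupM ?index2_sqr ?index2_conj ?index2_mulVr.
Qed.

Lemma index2_mulnn x y :
  x \in K -> y \in K -> x \notin F -> y \notin F -> (x * y)%g \in F.
Proof.
move=> Kx Ky nFx nFy; rewrite -(mulgKV d x) -mulgA.
by rewrite groupM ?index2_mulVr ?index2_mull.
Qed.

Lemma sum_index2 (V : nmodType) (f : lT -> V) :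
  \sum_(z in K) f z = \sum_(y in F) f y + \sum_(y in F) f (y * d)%g.
Proof.
rewrite (big_setID F) (setIidPr sFK) /=; congr (_ + _).
rewrite (reindex_inj (mulIg d)); apply: eq_bigl => y.
by rewrite -(rcoset_index2 sFK idx2 Kd) mem_rcoset mulgK.
Qed.

Variable k : fieldType.
Variables (n : nat) (X : mx_representation k F n).

(** The candidate extension of [X] to K, the union of F and F d, with [D] as the image of d. *)
Definition index2_ext_fun (D : 'M[k]_n) (x : lT) :=
  if x \in F then X x else X (x * d^-1)%g *m D.

Lemma index2_ext_mx_repr (D : 'M[k]_n) :
    (forall y, y \in F -> X (d * y * d^-1)%g *m D = D *m X y) ->
    D *m D = X (d * d)%g ->
  mx_repr K (index2_ext_fun D).
Proof.
move=> XD DD; rewrite /index2_ext_fun; split=> [|x y Kx Ky].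
  by rewrite group1 repr_mx1.
case: (boolP (x \in F)) => Fx; case: (boolP (y \in F)) => Fy.
- by rewrite groupM // repr_mxM.
- have Fyd := index2_mulVr Ky Fy.
  by rewrite groupMl // (negPf Fy) -mulgA (repr_mxM X Fx Fyd) mulmxA.
- have Fxd := index2_mulVr Kx Fx; have Fdy := index2_conj Fy.
  rewrite groupMr // (negPf Fx) -mulmxA -XD // mulmxA -(repr_mxM X Fxd Fdy).
  by rewrite !mulgA mulgKV.
have Fxd := index2_mulVr Kx Fx; have Fyd := index2_mulVr Ky Fy.
have Fdyd := index2_conj Fyd.
rewrite index2_mulnn // -mulmxA [D *m (_ *m _)]mulmxA -XD // -[_ *m D *m D]mulmxA.
rewrite DD -(repr_mxM X Fdyd index2_sqr) -(repr_mxM X Fxd).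
  by rewrite !mulgA !mulgKV.
by rewrite groupM ?index2_sqr.
Qed.

(** The induced representation for the transversal t = (1, d): block (i, j) is X(t_i x t_j^-1), or 0
    when the argument lies outside F. *)
Definition index2_ind_fun (x : lT) :=
  if x \in F then block_mx (X x) 0 0 (X (d * x * d^-1)%g)
  else block_mx 0 (X (x * d^-1)%g) (X (d * x)%g) 0.

Lemma index2_ind_mx_repr : mx_repr K index2_ind_fun.
Proof.
rewrite /index2_ind_fun; split=> [|x y Kx Ky].
  by rewrite group1 mulg1 mulgV !repr_mx1 -scalar_mx_block.
case: (boolP (x \in F)) => Fx; case: (boolP (y \in F)) => Fy.
- rewrite groupM // mulmx_block !(mulmx0, mul0mx, addr0, add0r).
  have Fdx := index2_conj Fx; have Fdy := index2_conj Fy.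
  by rewrite -(repr_mxM X Fx Fy) -(repr_mxM X Fdx Fdy) !mulgA mulgKV.
- rewrite groupMl // (negPf Fy) mulmx_block !(mulmx0, mul0mx, addr0, add0r).
  have Fdx := index2_conj Fx; have Fyd := index2_mulVr Ky Fy.
  have Fdy := index2_mull Ky Fy.
  by rewrite -(repr_mxM X Fx Fyd) -(repr_mxM X Fdx Fdy) !mulgA mulgKV.
- rewrite groupMr // (negPf Fx) mulmx_block !(mulmx0, mul0mx, addr0, add0r).
  have Fdx := index2_mull Kx Fx; have Fxd := index2_mulVr Kx Fx.
  have Fdy := index2_conj Fy.
  by rewrite -(repr_mxM X Fxd Fdy) -(repr_mxM X Fdx Fy) !mulgA mulgKV.
have Fdx := index2_mull Kx Fx; have Fxd := index2_mulVr Kx Fx.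
have Fdy := index2_mull Ky Fy; have Fyd := index2_mulVr Ky Fy.
rewrite index2_mulnn // mulmx_block !(mulmx0, mul0mx, addr0, add0r).
by rewrite -(repr_mxM X Fxd Fdy) -(repr_mxM X Fdx Fyd) !mulgA mulgKV.
Qed.
Definition index2_ind := MxRepresentation index2_ind_mx_repr.

End IndexTwo.

(** * The sum of the traces of squares over the nontrivial coset *)

Section TwistedIndicator.
Variables (k : closedFieldType) (lT : finGroupType) (K F : {group lT}) (d : lT).
Hypotheses (sFK : F \subset K) (idx2 : #|K : F|%g = 2%N) (Kd : d \in K :\: F).
Hypothesis charK : [pchar k]^'.-group K.
Variables (n : nat) (X : mx_representation k F n).
Hypothesis irrX : mx_irreducible X.

(** Mackey's criterion. In an endomorphism with blocks a, b, c, e, commutation with F makes a a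
    scalar and b an intertwiner from [X] to its conjugate, so b = 0; commutation with d then gives c
    = 0 and e = a. *)
Lemma index2_ind_irr :
    (forall b, (forall y, y \in F -> X y *m b = b *m X (d * y * d^-1)%g) ->
      b = 0) ->
  mx_irreducible (index2_ind sFK idx2 Kd X).
Proof.
move=> noX; have [n0 _] := (mx_irrP X).1 irrX.
have [dK dF] := setDP Kd.
apply: centg_scalar_irr charK _ _ => [|P /centgmxP cP].
  by rewrite addn_gt0 n0.
rewrite -[P]submxK in cP *; move: cP.
set a := ulsubmx P; set b := ursubmx P; set c := dlsubmx P; set e := drsubmx P.
move=> cP.
have Fcom y : y \in F -> a *m X y = X y *m a /\ X y *m b = b *m X (d * y * d^-1)%g.
  move=> Fy; have := cP y (subsetP sFK _ Fy).
  rewrite /= /index2_ind_fun Fy !mulmx_block !(mulmx0, mul0mx, addr0, add0r).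
  by case/eq_block_mx=> -> -> _ _.
have b0 : b = 0 by apply: noX => y /Fcom[].
have [x aE]: exists x, a = x%:M.
  by apply: (closed_irr_centg_scalar irrX); apply/centgmxP=> y /Fcom[].
have := cP d dK.
rewrite /= /index2_ind_fun (negPf dF) mulgV repr_mx1.
rewrite !mulmx_block !(mulmx0, mul0mx, addr0, add0r, mulmx1, mul1mx) b0 mul0mx.
case/eq_block_mx=> <- <- _ _.
by rewrite aE -scalar_mx_block scalar_mx_is_scalar.
Qed.

Lemma index2_sqr_in z : z \in K -> (z ^+ 2)%g \in F.
Proof.
move=> Kz; case: (boolP (z \in F)) => [Fz|nFz]; first by rewrite groupX.
exact: (index2_mulnn sFK idx2 Kd).
Qed.

Lemma index2_char : [/\ [pchar k]^'.-group F, #|F|%:R != 0 :> k & 2%:R != 0 :> k].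
Proof.
have := charK; rewrite /pgroup !pcharf'_nat -(Lagrange sFK) idx2 natrM mulf_eq0.
by case/norP.
Qed.

Lemma card_index2 : #|K|%:R = #|F|%:R * 2%:R :> k.
Proof. by rewrite -natrM -idx2 Lagrange. Qed.

(** Both D^2 and X(d^2) intertwine [X] with its conjugate by d^2, so they differ by a scalar c;
    dividing [D] by a square root of c gives an admissible image of d. *)
Lemma index2_extension (D : 'M_n) :
    D \in unitmx -> (forall y, y \in F -> X (d * y * d^-1)%g *m D = D *m X y) ->
  exists2 W : mx_representation k K n,
    mx_irreducible W & {in F, forall y, W y = X y}.
Proof.
move=> uD XD; have Fdd := index2_sqr sFK idx2 Kd.
have uQ : X (d * d)%g \in unitmx by apply: repr_mx_unit.
have [c Dc] : exists c, invmx (X (d * d)%g) *m (D *m D) = c%:M.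
  apply: (closed_irr_centg_scalar irrX); apply/centgmxP=> y Fy.
  have Fdy := index2_conj sFK idx2 Kd Fy.
  rewrite -!mulmxA -XD // [D *m (_ *m _)]mulmxA -XD //.
  rewrite -[X in _ *m X = _]mulmxA; apply: (canLR (mulKmx uQ)).
  have -> : X (d * (d * y * d^-1) * d^-1)%g =
      X (d * d)%g *m X y *m invmx (X (d * d)%g).
    apply: (canRL (mulmxK uQ)); rewrite -!repr_mxM //.
      by rewrite !mulgA !mulgKV.
    by apply: (index2_conj sFK idx2 Kd).
  by rewrite !mulmxA.
have DD : D *m D = c *: X (d * d)%g.
  by rewrite -mul_mx_scalar -Dc mulKVmx.
have [s s2] : exists s, s ^+ 2 = c.
  have /closed_rootP[s] : size ('X^2 - c%:P : {poly k}) != 1%N.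
    by rewrite size_XnsubC.
  by rewrite rootE !hornerE subr_eq0 => /eqP; exists s.
have [n0 _] := (mx_irrP X).1 irrX.
have nzs : s != 0.
  apply: contraTneq uD => s0; apply/negP=> uD.
  have : D *m D \in unitmx by rewrite unitmx_mul uD.
  rewrite DD -s2 s0 expr0n scale0r -row_free_unit /row_free mxrank0.
  by rewrite eq_sym -[_ == _]negbK -lt0n n0.
have XsD y : y \in F -> X (d * y * d^-1)%g *m (s^-1 *: D) = s^-1 *: D *m X y.
  by move=> Fy; rewrite -scalemxAr XD // scalemxAl.
have sDD : s^-1 *: D *m (s^-1 *: D) = X (d * d)%g.
  rewrite -scalemxAl -scalemxAr DD !scalerA -s2 expr2 mulrA mulfVK ?invr_eq0 //.
  by rewrite mulVf // scale1r.
exists (MxRepresentation (index2_ext_mx_repr sFK idx2 Kd XsD sDD)); last first.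
  by move=> y Fy; rewrite /= /index2_ext_fun Fy.
(* The extension is irreducible because its restriction to F already is. *)
apply: (subg_mx_irr (sHG := sFK)); apply: mx_rsim_irr irrX.
exists 1%:M => // [|y Fy]; first by rewrite row_free_unit unitmx1.
by rewrite mulmx1 mul1mx /= /index2_ext_fun Fy.
Qed.

Lemma index2_twisted_indicator (B : 'M_n) :
    B \in unitmx ->
    (forall y, y \in F -> X (d * y * d^-1)%g *m B = B *m (X y^-1%g)^T) ->
    (forall m (W : mx_representation k K m),
      mx_irreducible W -> classical_indicator W = 1) ->
  \sum_(y in F) \tr (X (y * d * (y * d))%g) = #|F|%:R.
Proof.
move=> uB XdB indK; have [charF nzF nz2] := index2_char.
have Nd := index2_norm sFK idx2 Kd; have Fdd := index2_sqr sFK idx2 Kd.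
have nzK : #|K|%:R != 0 :> k by rewrite card_index2 mulf_neq0.
have sumK m (W : mx_representation k K m) : mx_irreducible W ->
    \sum_(z in K) \tr (W (z ^+ 2)%g) = #|F|%:R * 2%:R.
  move=> /indK /(congr1 ( *%R #|K|%:R)).
  by rewrite /classical_indicator mulVKf // mulr1 card_index2.
(* Similarity to the dual is not a decidable proposition; the case split is allowed because the goal
   has been made boolean. *)
apply/eqP; apply: (@classic_EM (mx_rsim X (dual_repr X)) (_ == _)).
move=> -[sim|nsim]; apply/eqP.
  have [B1 _ uB1 XB1] := sim; rewrite row_free_unit in uB1.
  have XBt y : y \in F -> X y *m B1 = B1 *m (X y^-1%g)^T by apply: XB1.
  (* [B] takes the conjugate of [X] to its dual, and the inverse of [B1] takes the dual back to
     [X]. *)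
  have [||W irrW WX] := @index2_extension (B *m invmx B1).
  - by rewrite unitmx_mul uB unitmx_inv.
  - move=> y Fy; rewrite mulmxA XdB // -!mulmxA; congr (_ *m _).
    by apply: (canRL (mulKmx uB1)); rewrite mulmxA -XBt ?mulmxK.
  have [e e2 sumd] := twisted_indicator_sign charF irrX Nd Fdd uB XdB.
  (* With d = 1 the twisted sum is the ordinary indicator sum of [X]. *)
  have [|||y Fy|e1 e12 sum1] := @twisted_indicator_sign _ _ _ _ X 1%g B1 charF irrX.
  - by rewrite group1.
  - by rewrite mulg1 group1.
  - by [].
  - by rewrite mul1g invg1 mulg1 XB1.
  have := sumK _ _ irrW; rewrite (sum_index2 sFK idx2 Kd).
  rewrite (eq_bigr (fun y => \tr (X (y * 1 * (y * 1))%g))) => [|y Fy]; last first.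
    by rewrite WX ?groupX // mulg1.
  rewrite [X in _ + X](eq_bigr (fun y => \tr (X (y * d * (y * d))%g))); last first.
    move=> y Fy; rewrite WX // index2_sqr_in //.
    by rewrite groupM ?(subsetP sFK _ Fy) //; case/setDP: Kd.
  rewrite sum1 sumd -mulrDr => /(mulfI nzF) e1e.
  suff -> : e = 1 by rewrite mulr1.
  have e1E : e1 = 2%:R - e by rewrite -e1e addrK.
  (* From e + e1 = 2 and e^2 = e1^2 it follows that 4(1 - e) = 0, and 2 is invertible. *)
  have : 2%:R * (2%:R * (1 - e)) = e1 ^+ 2 - e ^+ 2 by rewrite e1E; ring.
  rewrite e12 e2 subrr => /eqP; rewrite !mulf_eq0 (negPf nz2) /= subr_eq0.
  by move/eqP.
have : \sum_(y in F) \tr (X (y * y)%g) = 0 by apply: sum_tr_sqr_nondual.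
have irrI : mx_irreducible (index2_ind sFK idx2 Kd X).
  (* A nonzero intertwiner b from [X] to its conjugate, followed by [B], would make [X]
     self-dual. *)
  apply: index2_ind_irr => b hb; apply/eqP; apply: contra_notT nsim => nzb.
  exists (b *m B) => //; last first.
    by move=> y Fy; rewrite mulmxA hb // -!mulmxA XdB.
  apply: (@intertwiner_row_free _ _ _ _ _ X (dual_repr X)) => //.
    by move=> y Fy; rewrite mulmxA hb // -!mulmxA XdB.
  by apply: contraNneq nzb => bB; rewrite -[b](mulmxK uB) bB mul0mx.
have : \sum_(z in K) \tr (X (z ^+ 2)%g) = #|F|%:R.
  (* On squares the induced trace is that of [X] plus that of its conjugate, that is tr X(z^2) + tr
     X(z^-2); the substitution of z^-1 for z shows that both halves have the same sum over K. *)
  apply: (mulIf nz2); rewrite -(sumK _ _ irrI) mulr_natr mulr2n.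
  rewrite [X in _ + X](reindex_inj invg_inj).
  rewrite [X in _ + X](eq_bigl (mem K)) => [|z]; last by rewrite /= groupV.
  rewrite -big_split; apply: eq_bigr => z Kz /=; have Fz2 := index2_sqr_in Kz.
  rewrite /index2_ind_fun Fz2 mxtrace_block; congr (_ + _).
  have -> : X (d * z ^+ 2 * d^-1)%g = B *m (X (z^-1 ^+ 2)%g)^T *m invmx B.
    by rewrite expgVn -XdB // mulmxK.
  by rewrite mxtrace_mulC mulmxA mulVmx // mul1mx mxtrace_tr.
rewrite (sum_index2 sFK idx2 Kd) => <- ->.
by rewrite add0r.
Qed.

End TwistedIndicator.

(** * Square traces and stabilizer modules for the smash product *)

Section SmashModules.
Variables (k : fieldType) (lT gT : finGroupType) (act : autAction lT gT).
Local Notation H := (smash k act).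
Local Notation p := (smash_p k act).

Lemma smash_mult_comult (a : H) :
  smash_mult (comult a) =
    \sum_u a u *: \sum_h p h u.2 * p (h^-1 * u.1)%g u.2.
Proof.
apply/ffunP=> -[g z]; rewrite smash_multE sum_ffunE.
under eq_bigr do rewrite sum_ffunE; rewrite exchange_big /=.
apply: eq_bigr => u _; rewrite ffunE sum_ffunE.
under eq_bigr do rewrite ffunE sum_ffunE; rewrite -scaler_sumr; congr (_ *: _).
rewrite exchange_big; apply: eq_bigr => h _ /=.
by rewrite smash_mulE; apply: eq_bigr => x _; rewrite ffunE.
Qed.

Lemma card_transporter g y :
  #|transporter act g (act y g)| = #|Lstab act g|.
Proof.
rewrite -(card_lcoset (Lstab act g) y); apply: eq_card => x.
by rewrite mem_lcoset !inE lactM (can2_eq (lactVK act y) (lactK act y)).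
Qed.

Variables (n : nat) (rho : {lrmorphism H -> 'M[k]_n.+1}).
Local Notation P g x := (rho (p g x)).

Lemma rho_pM g x h y :
  P g x *m P h y = if g == act x h then P g (x * y)%g else 0.
Proof.
by rewrite mulmxE -rmorphM /= smash_pM; case: ifP => _ //; rewrite rmorph0.
Qed.

Definition sqr_trace h := \sum_(x in transporter act h h^-1%g) \tr (P h (x * x)%g).

(** The product of p_h x and p_(h^-1) x is p_h x^2 when x.h = h^-1, and 0 otherwise. *)
Lemma schur_indicatorE :
  schur_indicator (#|lT|%:R^-1 *: \sum_x p 1%g x) rho =
    #|lT|%:R^-1 * \sum_h sqr_trace h.
Proof.
rewrite /schur_indicator smash_mult_comult.
pose f u := \sum_h p h u.2 * p (h^-1 * u.1)%g u.2.
have -> : \sum_u (#|lT|%:R^-1 *: \sum_x p 1%g x) u *: f u =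
   #|lT|%:R^-1 *: \sum_x f (1%g, x).
  transitivity (\sum_u \sum_x #|lT|%:R^-1 *: ((p 1%g x u : k) *: f u)).
    apply: eq_bigr => u _; rewrite ffunE sum_ffunE -scaler_sumr -scaler_suml.
    by rewrite scalerA.
  rewrite exchange_big scaler_sumr; apply: eq_bigr => x _ /=.
  by rewrite -scaler_sumr sum_smash_p.
rewrite linearZ /= linearZ /= [rho _]linear_sum linear_sum; congr (_ * _).
rewrite /f /=; under eq_bigr do rewrite linear_sum linear_sum.
rewrite exchange_big; apply: eq_bigr => h _ /=.
rewrite /sqr_trace [RHS]big_mkcond; apply: eq_bigr => x _.
rewrite mulg1 rmorphM /= -mulmxE rho_pM inE lactV.
rewrite -[in LHS](can_eq (@invgK _)) invgK eq_sym.
by case: ifP; rewrite ?linear0.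
Qed.

(** Conjugation by y matches the two index sets. As x^2 fixes g, the term for y x y^-1 factors as
    (p_(y.g) y)(p_g x^2)(p_g y^-1), and the trace is cyclic. *)
Lemma sqr_trace_act y g : sqr_trace (act y g) = sqr_trace g.
Proof.
rewrite /sqr_trace (reindex_inj (conjg_inj y^-1%g)).
apply: eq_big => [x|x].
  rewrite !inE conjgE invgK -lactV !lactM lactK.
  by rewrite (inj_eq (can_inj (lactK act y))).
rewrite inE conjgE invgK => xg.
have gx : act (x * x)%g g = g.
  move: xg; rewrite -lactV !lactM lactK (inj_eq (can_inj (lactK act y))).
  by move=> /eqP gx; rewrite gx lactV gx invgK.
have -> : (y * (x * y^-1) * (y * (x * y^-1)) = y * (x * x) * y^-1)%g.
  by rewrite !mulgA mulgKV.
have -> : P (act y g) (y * (x * x) * y^-1)%g =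
    P (act y g) y *m P g (x * x)%g *m P g y^-1%g.
  by rewrite rho_pM eqxx rho_pM lactM gx eqxx.
rewrite mxtrace_mulC mulmxA rho_pM lactK eqxx mulVg rho_pM lact1 eqxx.
by rewrite mul1g.
Qed.

Hypothesis rho_simple : simple_module rho.

(** The vectors p_g x v span a submodule that contains v, hence the whole space. *)
Lemma simple_annihilator m (M : 'M_(m, n.+1)) (v : 'cV_n.+1) :
  v != 0 -> (forall g x, M *m (P g x *m v) = 0) -> M = 0.
Proof.
move=> nzv Mv; pose U := <<[seq P u.1 u.2 *m v | u : gT * lT]>>%VS.
have memU a : rho a *m v \in U.
  rewrite [a]smash_sumE rmorph_sum mulmx_suml memv_suml // => u _.
  rewrite /= linearZ /= -scalemxAl memvZ // memv_span //.
  by apply/imageP; exists u.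
have [a w|U0|U1] := rho_simple (W := U).
- rewrite -[rho a *m w](lfunE (mulmx (rho a))) => Uw.
  have : linfun (mulmx (rho a)) w \in (linfun (mulmx (rho a)) @: U)%VS.
    exact: memv_img.
  apply: subvP; rewrite limg_span; apply/span_subvP=> _ /mapP[_ /imageP[u _ ->] ->].
  by rewrite lfunE /= mulmxA mulmxE -rmorphM memU.
- have := memU 1; rewrite rmorph1 mul1mx U0 memv0 => v0.
  by rewrite v0 in nzv.
have MU (w : 'cV_n.+1) : M *m w = 0.
  have : w \in U by rewrite U1 memvf.
  move/(subvP (_ : (U <= lker (linfun (mulmx M)))%VS)) => MU.
  have: w \in lker (linfun (mulmx M)).
    apply: MU; apply/span_subvP=> _ /imageP[u _ ->].
    by rewrite memv_ker lfunE /= Mv.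
  by rewrite memv_ker lfunE => /eqP.
apply/matrixP=> i j.
by have /matrixP/(_ i 0) := MU (delta_mx j 0); rewrite -colE !mxE.
Qed.

(** In the rank factorization A = C R, idempotence reads C (R C) R = C R, where C cancels on the
    left and R on the right. *)
Lemma idempotent_baseK q (A : 'M[k]_q) :
  A *m A = A -> row_base A *m col_base A = 1%:M.
Proof.
move: (col_base_full A) (row_base_free A) (mulmx_base A).
move: (col_base A) (row_base A) => C R fC fR CR AA.
apply: (row_full_inj fC); apply: (row_free_inj fR) => /=.
by rewrite mulmx1 -!mulmxA [C *m (_ *m _)]mulmxA !CR AA.
Qed.

Lemma nonzero_col m q (A : 'M[k]_(m, q)) : A != 0 -> exists i, col i A != 0.
Proof.
move=> nzA; apply/existsP; rewrite -negb_forall; apply: contra nzA.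
move=> /forallP col0; apply/eqP/matrixP=> i j.
by have /eqP/matrixP/(_ i 0) := col0 j; rewrite !mxE.
Qed.

(** Summing the constant value over all y.g with y in L meets each point of the orbit |L_g| times;
    points off the orbit contribute 0. *)
Lemma sqr_trace_orbit g : P g 1%g != 0 ->
  #|lT|%:R * sqr_trace g = #|Lstab act g|%:R * \sum_h sqr_trace h.
Proof.
move=> nzPg; rewrite mulr_natl -sumr_const.
under eq_bigl do rewrite inE.
under eq_bigr => y _ do rewrite -(sqr_trace_act y).
rewrite (partition_big (fun y => act y g) predT) //= mulr_sumr.
apply: eq_bigr => h _.
under eq_bigr => y /eqP -> do [].
rewrite (eq_bigl (mem (transporter act g h))) => [|y]; last by rewrite !inE.
rewrite sumr_const -[LHS]mulr_natl.
case: (pickP (mem (transporter act g h))) => [y | noy].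
  by rewrite /= inE => /eqP <-; rewrite card_transporter.
suff -> : sqr_trace h = 0 by rewrite !mulr0.
have [i nz] := nonzero_col nzPg.
(* A nonzero column of p_g generates the module, and p_h kills every p_g' x p_g because h is not of
   the form x.g. *)
have Ph0 : P h 1%g = 0.
  apply: (simple_annihilator nz) => g' x.
  rewrite colE !mulmxA rho_pM lact1; case: eqP => _; last by rewrite !mul0mx.
  rewrite mul1g rho_pM; case: eqP => [hg|_]; last by rewrite !mul0mx.
  by have := noy x; rewrite /= inE hg eqxx.
apply: big1 => x _; rewrite -[(x * x)%g]mul1g.
have := rho_pM h 1%g h (x * x)%g.
by rewrite lact1 eqxx Ph0 mul0mx => <-; rewrite linear0.
Qed.

Section StabilizerModule.
Variables (g : gT) (r : nat) (C : 'M[k]_(n.+1, r)) (R : 'M[k]_(r, n.+1)).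
Hypotheses (CR : C *m R = P g 1%g) (RC : R *m C = 1%:M).

(** [C] and [R] identify k^r with the image of p_g, on which y in L_g acts through p_g y. *)
Definition stab_fun (y : lT) := R *m P g y *m C.

Lemma stab_mx_repr : mx_repr (Lstab act g) stab_fun.
Proof.
rewrite /stab_fun; split=> [|x y].
  by rewrite -CR mulmxA RC mul1mx RC.
rewrite !inE => /eqP gx /eqP gy.
rewrite !mulmxA -[R *m P g x *m C *m R]mulmxA CR -[R *m _ *m P g 1%g]mulmxA.
rewrite rho_pM gx eqxx mulg1 -[R *m _ *m P g y]mulmxA rho_pM gx eqxx //.
Qed.
Definition stab_repr := MxRepresentation stab_mx_repr.

Lemma tr_stab_repr y : \tr (stab_repr y) = \tr (P g y).
Proof.
rewrite /= /stab_fun -mulmxA mxtrace_mulC -mulmxA CR mxtrace_mulC.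
by rewrite rho_pM lact1 eqxx mul1g.
Qed.

(** A proper row submodule [U] kills some column w. Then U R kills all p_h x C w: these products
    vanish unless h = g and x lies in L_g, and then U X(x) w is a multiple of U w = 0. As C w
    generates, U R = 0 and so U = U R C = 0. *)
Lemma stab_repr_irr : P g 1%g != 0 -> mx_irreducible stab_repr.
Proof.
move=> nzE; apply/mx_irrP; split=> [|U modU nzU].
  rewrite lt0n; apply: contra nzE => /eqP r0; rewrite -CR -mxrank_eq0 -leqn0.
  by apply: leq_trans (mxrankM_maxr _ _) _; rewrite -r0 rank_leq_row.
rewrite -cokermx_eq0; apply: contraT => /nonzero_col[i nzw].
set w := col i _ in nzw; have Uw : U *m w = 0.
  by rewrite /w colE mulmxA mulmx_coker mul0mx.
have UR0 : U *m R = 0.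
  apply: (@simple_annihilator _ _ (C *m w)) => [|h x].
    by apply: contraNneq nzw => Cw0; rewrite -[w]mul1mx -RC -mulmxA Cw0 mulmx0.
  have CE : C = P g 1%g *m C by rewrite -CR -mulmxA RC mulmx1.
  have RE : R = R *m P g 1%g by rewrite -CR mulmxA RC mul1mx.
  rewrite RE CE !mulmxA -[U *m R *m P g 1%g *m _]mulmxA rho_pM lact1.
  case: eqP => _; last by rewrite mulmx0 !mul0mx.
  rewrite mul1g -[U *m R *m _ *m P g 1%g]mulmxA rho_pM.
  case: eqP => [gx|_]; last first.
    by rewrite mulmx0 !mul0mx.
  have /submxP[D UD] : (U *m stab_repr x <= U)%MS.
    by apply: (mxmoduleP modU); rewrite inE -gx.
  rewrite mulg1 -[U *m R *m _]mulmxA -[U *m _ *m C]mulmxA -/(stab_repr x).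
  by rewrite UD -mulmxA Uw mulmx0.
by rewrite -[U]mulmx1 -RC mulmxA UR0 mul0mx eqxx in nzU.
Qed.


End StabilizerModule.
End SmashModules.

(** * The indicator of a simple module *)

Lemma pchar'_nat_coprime (k : fieldType) (m : nat) :
    (0 < m)%N -> (forall p, p \in [pchar k] -> ~~ (p %| m)%N) ->
  [pchar k]^'.-nat m.
Proof.
move=> m0 copr; apply/pnatP => // p _ pm; rewrite inE /=.
by apply: contraL pm; apply: copr.
Qed.

Theorem theorem6p1 (k : closedFieldType) (gT lT : finGroupType)
    (act : autAction lT gT)
    (char_not2 : 2%N \notin [pchar k])
    (char_coprime : forall p : nat, p \in [pchar k] -> ~~ (p %| #|gT| * #|lT|)%N)
    (cond_i : forall (g : gT) (n : nat)
                (rV : mx_representation k (Ltilde act g) n),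
        mx_irreducible rV -> classical_indicator rV = 1)
    (cond_ii : forall (g : gT) (d : lT) (d_Lt : d \in Ltilde act g),
        d \notin Lstab act g ->
        forall (n : nat) (rV : mx_representation k (Lstab act g) n),
          mx_rsim (conj_repr d_Lt rV) (dual_repr rV))
    (cond_iii : forall g : gT,
        (3 <= #[g]%g)%N -> Ltilde act g <> Lstab act g)
    (Lam : smash k act)
    (Lam_integral : left_integral Lam)
    (Lam_normalized : counit Lam = 1)
    (n : nat) (rho : {lrmorphism smash k act -> 'M[k]_n.+1})
    (rho_simple : simple_module rho) :
  schur_indicator Lam rho = 1.
Proof.
have charL : [pchar k]^'.-nat #|lT|.
  apply: pchar'_nat_coprime; first by apply/card_gt0P; exists 1%g.
  by move=> p /char_coprime; apply: contra => /dvdn_mull ->.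
have nzL : #|lT|%:R != 0 :> k by rewrite -pcharf'_nat.
have charLt g : [pchar k]^'.-group (Ltilde act g).
  by apply: pnat_dvd charL; rewrite -cardsT; apply: cardSg (subsetT _).
have -> : Lam = #|lT|%:R^-1 *: \sum_x smash_p k act 1%g x.
  exact/(smash_integralP _ nzL).
rewrite schur_indicatorE.
(* The p_h 1 sum to the unit, so they cannot all act by zero. *)
have [g nzg] : exists g, rho (smash_p k act g 1%g) != 0.
  apply/existsP; rewrite -negb_forall; apply/negP => /forallP Pg0.
  have : rho (smash_one k act) = 1 by apply: rmorph1.
  rewrite raddf_sum big1 => [/eqP|h _]; last exact/eqP/Pg0.
  by rewrite eq_sym oner_eq0.
have EE : rho (smash_p k act g 1%g) *m rho (smash_p k act g 1%g) =
    rho (smash_p k act g 1%g).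
  by rewrite rho_pM lact1 eqxx mulg1.
have CR := mulmx_base (rho (smash_p k act g 1%g)).
have RC := idempotent_baseK EE.
pose X := stab_repr CR RC.
have irrX : mx_irreducible X by apply: stab_repr_irr.
have trX y : \tr (X y) = \tr (rho (smash_p k act g y)) by apply: tr_stab_repr.
have sLt : Lstab act g \subset Ltilde act g by apply: subsetUl.
have nzLs : #|Lstab act g|%:R != 0 :> k.
  rewrite -pcharf'_nat; exact: pgroupS sLt (charLt g).
suff sumT : sqr_trace rho g = #|Lstab act g|%:R.
  have := sqr_trace_orbit rho_simple nzg; rewrite sumT mulrC => /(mulfI nzLs) <-.
  by rewrite mulVf.
(* If g = g^-1 the two groups coincide, and [X] is carried over to the larger one to apply (i). *)
have [gV|gV] := eqVneq g^-1%g g.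
  have eqL : Lstab act g = Ltilde act g.
    by rewrite /Ltilde gV setUid.
  have eqLb : Lstab act g :==: Ltilde act g by rewrite eqL.
  have := cond_i g _ (@eqg_repr _ _ _ (Ltilde_group act g) _ X eqLb).
  move=> /(_ ((eqg_mx_irr _ _).2 irrX)); rewrite /classical_indicator.
  move=> /(congr1 ( *%R #|Ltilde act g|%:R)).
  rewrite mulVKf ?mulr1 -?eqL // => <-.
  rewrite /sqr_trace gV; apply: eq_big => [x|x _]; last by rewrite -trX.
  by rewrite /= -eqL.
have ord3 : (3 <= #[g]%g)%N.
  rewrite ltnNge; apply: contra gV => g2.
  have : (#[g] %| 2)%N by move: g2 (order_gt0 g); case: #[g]%g => [|[|[|]]].
  by rewrite order_dvdn expgS expg1 -eq_invg_mul eq_sym.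
have [d dLt dLs] : exists2 d, d \in Ltilde act g & d \notin Lstab act g.
  by apply/subsetPn; apply: contra_notN (cond_iii g ord3) => sL;
     apply/eqP; rewrite eqEsubset sL sLt.
have dT : act d g = g^-1%g.
  by move: dLt; rewrite inE (negPf dLs) inE => /eqP.
have Kd : d \in Ltilde act g :\: Lstab act g by rewrite inE dLs dLt.
have inT x : (x \in transporter act g g^-1%g) = (x \in Ltilde act g :\: Lstab act g).
  by rewrite !inE; case: eqP => [->|_]; rewrite ?gV ?orbT ?orbF ?andNb.
(* The complement of L_g is the transporter from g to g^-1, which has as many elements as L_g. *)
have idx2 : #|Ltilde act g : Lstab act g|%g = 2%N.
  have Ls0 : (0 < #|Lstab act g|)%N by apply: cardG_gt0.
  apply/eqP; rewrite -(eqn_pmul2l Ls0) Lagrange //.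
  rewrite -(cardsID (Lstab act g) (Ltilde act g)) (setIidPr sLt).
  rewrite muln2 -addnn eqn_add2l -(card_transporter _ g d) dT.
  by apply/eqP/eq_card => x; rewrite inT.
have [B _ uB XB] := cond_ii g d dLt dLs _ X; rewrite row_free_unit in uB.
have := index2_twisted_indicator sLt idx2 Kd (charLt g) irrX uB XB (cond_i g).
(* The transporter is the coset L_g d, so x = y d with y in L_g. *)
move=> <-; rewrite /sqr_trace (reindex_inj (mulIg d)).
apply: eq_big => [y|y _]; last by rewrite trX.
by rewrite !inE lactM dT lactV (inj_eq invg_inj).
Qed.
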